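(* Let $q>0$ with $q\neq 1$, let $s\in\mathbb{R}$, and let $\mathbb{E}$ be a complex Banach space. Then $\mathbb{E}[[t]]_{q,s}=\mathbb{E}[[t]]_{q,s,\star}$.
   Context: $\mathbb{E}$ is a complex Banach space with norm $\|\cdot\|_{\mathbb{E}}$; $\mathbb{E}[[t]]$ is the space of formal power series in $t$ with coefficients in $\mathbb{E}$. $\mathbb{E}[[t]]_{q,s}$ is the set of all formal power series $\sum_{p\ge0}a_pt^p\in\mathbb{E}[[t]]$ such that there exist $A,B>0$ and $\alpha\in\mathbb{R}$ with $\|a_p\|_{\mathbb{E}}\le AB^{p}p!^{\alpha}q^{s\frac{p(p-1)}{2}}$ for all integers $p\ge0$. $\mathbb{E}[[t]]_{q,s,\star}$ is the set of all formal power series $\sum_{p\ge0}a_pt^p\in\mathbb{E}[[t]]$ such that there exist $A,B>0$ and a sequence $\mathbb{M}=(M_p)_{p\ge0}$ of positive real numbers with $M_0=1$ satisfying (mg) and (lc), with $\|a_p\|_{\mathbb{E}}\le AB^{p}M_pq^{s\frac{p(p-1)}{2}}$ for all integers $p\ge0$. Here: (mg) (moderate growth): there exists $A'>0$ such that $M_{n+k}\le A'^{\,n+k}M_nM_k$ for all integers $n,k\ge0$; (lc) (logarithmic convexity): $M_n^2\le M_{n-1}M_{n+1}$ for every $n\ge1$. *)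

(* Defs.v *)
From HB Require Import structures.
From mathcomp Require Import all_boot all_order all_algebra.
From mathcomp Require Import all_classical all_reals all_analysis.
From mathcomp Require Import complex.

Set Implicit Arguments.
Unset Strict Implicit.
Unset Printing Implicit Defensive.

Import Order.TTheory GRing.Theory Num.Theory.
Import numFieldNormedType.Exports.

Local Open Scope classical_set_scope.
Local Open Scope complex_scope.
Local Open Scope ring_scope.

(* E[[t]]: the series [\sum_p a_p t^p] is encoded by its coefficient sequence. *)
Definition fps (E : Type) : Type := nat -> E.

Definition moderate_growth (R : realType) (M : nat -> R) : Prop :=
  exists2 A : R, 0 < A &
    forall n k : nat, M (n + k)%N <= A ^+ (n + k) * M n * M k.

Definition log_convex (R : realType) (M : nat -> R) : Prop :=
  forall n : nat, (1 <= n)%N -> M n ^+ 2 <= M n.-1 * M n.+1.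

Definition qfactor (R : realType) (q s : R) (p : nat) : R :=
  q `^ (s * (p%:R * (p%:R - 1) / 2)).

(* The norm of a normed space over [R[i]] takes its values in [R[i]], whose
   order [x <= y] means that [y - x] is a nonnegative real. Hence the real
   bounds below are embedded in [R[i]] by [_%:C]. *)
Definition fps_q (R : realType) (E : completeNormedModType R[i]) (q s : R) :
    set (fps E) :=
  [set a | exists A B alpha : R, [/\ 0 < A, 0 < B &
     forall p : nat,
       `|a p| <= (A * B ^+ p * p`!%:R `^ alpha * qfactor q s p)%:C]].

Definition fps_q_star (R : realType) (E : completeNormedModType R[i])
    (q s : R) : set (fps E) :=
  [set a | exists (A B : R) (M : nat -> R),
     [/\ 0 < A /\ 0 < B,
         (forall p : nat, 0 < M p) /\ M 0%N = 1,
         moderate_growth M, log_convex M &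
     forall p : nat, `|a p| <= (A * B ^+ p * M p * qfactor q s p)%:C]].

Arguments fps_q {R} E q s.
Arguments fps_q_star {R} E q s.

(* Main.v *)
(* If M has moderate growth with constant 2^k, then with n = p./2 and p = n + m,
   M_p <= 2^(k p) M_n M_m, and 2^(k p) <= 'C(p, n)^(3 k) for p >= 2. Since
   p! = 'C(p, n) n! m!, induction gives M_p <= (1 + M_1)^p p!^(3 k).
   Conversely, a real power of p! is dominated by a natural power, and
   M_p = p!^b has moderate growth because 'C(p, n) <= 2^p, and is log-convex. *)
Require Import Defs.
From mathcomp Require Import all_boot all_order all_algebra.
From mathcomp Require Import all_classical all_reals all_analysis.
From mathcomp Require Import complex.
From mathcomp Require Import zify.

Import Order.TTheory GRing.Theory Num.Theory.
Import numFieldNormedType.Exports.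

Local Open Scope complex_scope.
Local Open Scope ring_scope.

Lemma leq_bin_exp2 n m : ('C(n, m) <= 2 ^ n)%N.
Proof.
elim: n m => [|n IHn] [|m] //; first by rewrite bin0 expn_gt0.
by rewrite binS expnS mul2n -addnn leq_add.
Qed.

(** Induction on [n] through [(n+1) 'C(n+1+m, n+1) = (n+1+m) 'C(n+m, n)]: each step at least doubles
    the binomial, because [n+1 <= m] gives [2(n+1) <= n+1+m]. *)
Lemma exp2_leq_bin n m : (n <= m)%N -> (2 ^ n <= 'C(n + m, n))%N.
Proof.
elim: n m => [|n IHn] m; first by rewrite bin0.
move=> ltnm; rewrite -(leq_pmul2l (ltn0Sn n)) addSn -mul_bin_diag.
rewrite expnS mulnA leq_mul ?IHn ?(ltnW ltnm) //=; lia.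
Qed.

(** The cube comes from [p <= 3 * p./2], valid for [p >= 2] and an equality at [p = 3]. *)
Lemma exp2_leq_bin_half p : (1 < p)%N -> (2 ^ p <= 'C(p, p./2) ^ 3)%N.
Proof.
move=> p_gt1; apply: (@leq_trans ((2 ^ p./2) ^ 3)).
  by rewrite -expnM leq_exp2l //; lia.
rewrite leq_exp2r // -[in X in 'C(X, _)](_ : (p./2 + uphalf p = p)%N); last by lia.
by apply: exp2_leq_bin; lia.
Qed.

Lemma fact_half_bound k p : (1 < p)%N ->
  (2 ^ (k * p) * (p./2`! * (uphalf p)`!) ^ (3 * k) <= p`! ^ (3 * k))%N.
Proof.
move=> p_gt1; have hp : (p./2 <= p)%N by lia.
rewrite -(bin_fact hp) (_ : (p - p./2 = uphalf p)%N); last by lia.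
rewrite [in leqRHS]expnMn leq_mul // mulnC !expnM.
by case: k => // k; rewrite leq_exp2r // exp2_leq_bin_half.
Qed.

Lemma moderate_growth_factX (R : realType) b :
  moderate_growth (fun p => (p`! ^ b)%:R : R).
Proof.
exists (2 ^ b)%:R; first by rewrite ltr0n expn_gt0.
move=> n k; rewrite -natrX -!natrM ler_nat -expnM (mulnC b) expnM -!expnMn.
case: b => // b; rewrite leq_exp2r // -(bin_fact (leq_addr k n)) addKn.
by rewrite -mulnA leq_mul // leq_bin_exp2.
Qed.

Lemma log_convex_factX (R : realType) b : log_convex (fun p => (p`! ^ b)%:R : R).
Proof.
move=> [|n] // _; rewrite -natrX -natrM ler_nat /= -expnM (mulnC b) expnM -expnMn.
case: b => // b; rewrite leq_exp2r // !factS; nia.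
Qed.

Lemma moderate_growth_fact_bound (R : realType) (M : nat -> R) :
  (forall p, 0 < M p) -> M 0%N = 1 ->
  moderate_growth M ->
  exists a : nat, forall p, M p <= (1 + M 1%N) ^+ p * (p`! ^ a)%:R.
Proof.
move=> M_gt0 M0 [A A_gt0 mgM]; pose k := Num.bound A.
(* A power of two above [A], from [A < k < 2 ^ k], turns the growth factor into an integer
   comparable with binomials. *)
have leAk : A <= (2 ^ k)%:R.
  apply: (le_trans (ltW (archi_boundP (ltW A_gt0)))).
  by rewrite ler_nat ltnW // ltn_expl.
exists (3 * k)%N => p; elim/ltn_ind: p => p IHp.
(* Since [uphalf 1 = 1], both halves are smaller than [p] only from [p = 2] on; 0 and 1 are base
   cases. *)
have [|p_gt1] := leqP p 1.
  case: p IHp => [|[|//]] _ _; first by rewrite M0 expr0 exp1n mulr1.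
  by rewrite expr1 exp1n mulr1 lerDr.
have pE : p = (p./2 + uphalf p)%N by lia.
have B_ge0 : 0 <= 1 + M 1%N by rewrite addr_ge0 // ltW.
have lt1 : (p./2 < p)%N by lia.
have lt2 : (uphalf p < p)%N by lia.
rewrite {1}pE; apply: (le_trans (mgM _ _)); rewrite -pE.
apply: (@le_trans _ _ ((2 ^ (k * p))%:R *
    ((1 + M 1%N) ^+ p./2 * (p./2`! ^ (3 * k))%:R) *
    ((1 + M 1%N) ^+ uphalf p * ((uphalf p)`! ^ (3 * k))%:R))).
  apply: ler_pM; rewrite ?IHp ?(ltW (M_gt0 _)) //.
    by rewrite mulr_ge0 ?exprn_ge0 // ltW.
  apply: ler_pM; rewrite ?IHp ?(ltW (M_gt0 _)) ?exprn_ge0 ?(ltW A_gt0) //.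
  by rewrite expnM natrX lerXn2r // nnegrE // ltW.
(* The powers of [1 + M 1] recombine to exponent [p] and cancel, leaving an inequality between
   integers. *)
rewrite -mulrA mulrACA -exprD -pE (mulrCA _ ((1 + M 1%N) ^+ p)).
rewrite ler_wpM2l ?exprn_ge0 // -!natrM ler_nat -expnMn.
exact: fact_half_bound.
Qed.

Theorem proposition2 (R : realType) (q s : R) (E : completeNormedModType R[i])
  (hq0 : 0 < q) (hq1 : q <> 1) :
  fps_q E q s = fps_q_star E q s.
Proof.
apply/seteqP; split => a /=.
  (* The absolute value covers negative [alpha]. As [p! >= 1], raising the exponent from [alpha] to
     [b] only weakens the bound. *)
  move=> [A [B [alpha [A_gt0 B_gt0 ha]]]]; pose b := Num.bound `|alpha|.
  exists A, B, (fun p => (p`! ^ b)%:R); split => //.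
  - by split=> [p|]; rewrite ?exp1n // ltr0n expn_gt0 fact_gt0.
  - exact: moderate_growth_factX.
  - exact: log_convex_factX.
  move=> p; apply: (le_trans (ha p)); rewrite lecR.
  rewrite ler_wpM2r ?powR_ge0 // ler_wpM2l ?mulr_ge0 ?exprn_ge0 ?(ltW A_gt0) ?(ltW B_gt0) //.
  rewrite natrX -powR_mulrn // ler_powR ?ler1n ?fact_gt0 //.
  by rewrite (le_trans (ler_norm _)) // ltW // archi_boundP.
move=> [A [B [M [[A_gt0 B_gt0] [M_gt0 M0] mgM _ ha]]]].
have [c hM] := moderate_growth_fact_bound _ M M_gt0 M0 mgM.
(* The geometric factor [(1 + M 1) ^+ p] is absorbed into [B ^+ p]. *)
exists A, (B * (1 + M 1%N)), c%:R; split => //.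
  by rewrite mulr_gt0 // addr_gt0.
move=> p; apply: (le_trans (ha p)); rewrite lecR.
rewrite ler_wpM2r ?powR_ge0 // powR_mulrn // -natrX exprMn mulrA -[leRHS]mulrA.
by rewrite ler_wpM2l ?mulr_ge0 ?exprn_ge0 ?(ltW A_gt0) ?(ltW B_gt0).
Qed.
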